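(* Let $\mathcal{A}=\{A_0,A_1,A_2\}$ be the standard basis of a symmetric rank $3$ standard integral table algebra (e.g. the adjacency matrices of the association scheme of a strongly regular graph), with character table $$\begin{bmatrix}1&k&\ell\\ 1&r&-1-r\\ 1&s&-1-s\end{bmatrix},\qquad r\ge s .$$ (1) Let $\tau$ be a partition of $\{2,\dots,9\}$ each of whose blocks is a union of blocks of $2|3|456|789$. Then $\tau$ gives a fusion of $\mathcal{A}\otimes\mathcal{A}$ for every such $\mathcal{A}$ if and only if $\tau\in\{2|3|456|789,\ 2|3|456789,\ 23|456|789,\ 23|456789,\ 23456789\}$. For any other such $\tau$, $\tau$ gives a fusion of $\mathcal{A}\otimes\mathcal{A}$ if and only if either $k=r$, $s=-1$ and $\tau\in\{2|3456789,\ 23456|789,\ 2|3456|789\}$, or $\ell=-1-s$, $r=0$ and $\tau\in\{2456789|3,\ 23789|456,\ 2789|3|456\}$. (2) Let $\tau$ be a partition of $\{2,\dots,9\}$ each of whose blocks is a union of blocks of $258|369|4|7$. Then $\tau$ gives a fusion of $\mathcal{A}\otimes\mathcal{A}$ for every such $\mathcal{A}$ if and only if $\tau\in\{258|369|4|7,\ 258|369|47,\ 235689|4|7,\ 235689|47,\ 23456789\}$. For any other such $\tau$, $\tau$ gives a fusion if and only if either $k=r$, $s=-1$ and $\tau\in\{2356789|4,\ 24578|369,\ 2578|369|4\}$, or $\ell=-1-s$, $r=0$ and $\tau\in\{2345689|7,\ 258|34679,\ 258|3469|7\}$.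
   Context: A symmetric rank $3$ standard integral table algebra is a commutative associative complex algebra with basis $A_0=1,A_1,A_2$ such that the structure constants $\lambda_{ijh}$ ($A_iA_j=\sum_h\lambda_{ijh}A_h$) are nonnegative reals, $\lambda_{ij0}=0$ for $i\neq j$, and $\lambda_{ii0}=\delta(A_i)$ is a positive integer, where $\delta$ is the valency homomorphism $\delta(A_i)=\lambda_{ii0}$. Main example: $A_0=I_n$, $A_1$ the adjacency matrix of a strongly regular graph (neither complete nor edgeless), $A_2=J-I-A_1$. Set $k=\delta(A_1)$, $\ell=\delta(A_2)$; the character table has rows the characters $\chi_0=\delta,\chi_1,\chi_2$ and columns $A_0,A_1,A_2$. The tensor square $\mathcal{A}\otimes\mathcal{A}$ has basis $A_{ij}=A_i\otimes A_j$, relabelled $C_{3j+i+1}=A_{ij}$: $C_1=A_{00},C_2=A_{10},C_3=A_{20},C_4=A_{01},C_5=A_{11},C_6=A_{21},C_7=A_{02},C_8=A_{12},C_9=A_{22}$. Partitions of $\{2,\dots,9\}$ are written with blocks separated by bars. A partition $\tau$ gives a fusion of $\mathcal{A}\otimes\mathcal{A}$ if the span of $C_1$ and the block sums $\sum_{t\in T}C_t$ ($T$ a block of $\tau$) is closed under multiplication. (The partition $2|3|456|789$ corresponds to the wreath product $(\mathcal{A}\otimes1)\wr(1\otimes\mathcal{A})$ and $258|369|4|7$ to $(1\otimes\mathcal{A})\wr(\mathcal{A}\otimes 1)$.) *)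

(* Defs.v *)
From HB Require Import structures.
From mathcomp Require Import all_boot all_order all_algebra all_field.
From mathcomp Require Import complex.
From mathcomp Require Import reals ring.

Set Implicit Arguments.
Unset Strict Implicit.
Unset Printing Implicit Defensive.

Import Order.TTheory GRing.Theory Num.Theory.
Import VectorInternalTheory.

Local Open Scope ring_scope.

(* An element of the tensor product of two finite-dimensional algebras is
   represented by its matrix of coefficients on the e_i (x) f_j, where e and f
   are the coordinate bases that v2r fixes on A and B. *)
Definition tensor (K : fieldType) (A B : falgType K) :=
  'M[K]_(dim A, dim B).

HB.instance Definition _ (K : fieldType) (A B : falgType K) :=
  Vector.on (tensor A B).

Section Tensor.
Variables (K : fieldType) (A B : falgType K).
Implicit Types (a c : A) (b d : B) (x y z : tensor A B).

Definition tens a b : tensor A B := (v2r a)^T *m v2r b.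

Definition tens_mul x y : tensor A B :=
  \sum_i \sum_j \sum_k \sum_l (x i j * y k l) *:
    tens (r2v (delta_mx 0 i) * r2v (delta_mx 0 k))
         (r2v (delta_mx 0 j) * r2v (delta_mx 0 l)).

Lemma tensDl a c b : tens (a + c) b = tens a b + tens c b.
Proof. by rewrite /tens !linearD /= mulmxDl. Qed.

Lemma tensDr a b d : tens a (b + d) = tens a b + tens a d.
Proof. by rewrite /tens linearD /= mulmxDr. Qed.

Lemma tensZl k a b : tens (k *: a) b = k *: tens a b.
Proof. by rewrite /tens !linearZ /= -scalemxAl. Qed.

Lemma tensZr k a b : tens a (k *: b) = k *: tens a b.
Proof. by rewrite /tens linearZ /= -scalemxAr. Qed.

Lemma tens0l b : tens 0 b = 0.
Proof. by rewrite -(scale0r 0) tensZl scale0r. Qed.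

Lemma tens0r a : tens a 0 = 0.
Proof. by rewrite -(scale0r 0) tensZr scale0r. Qed.

Lemma tens_suml I (r : seq I) (P : pred I) F b :
  tens (\sum_(i <- r | P i) F i) b = \sum_(i <- r | P i) tens (F i) b.
Proof.
by apply: (big_morph (tens^~ b)) => [u v|]; rewrite ?tensDl ?tens0l.
Qed.

Lemma tens_sumr I (r : seq I) (P : pred I) a F :
  tens a (\sum_(i <- r | P i) F i) = \sum_(i <- r | P i) tens a (F i).
Proof. by apply: (big_morph (tens a)) => [u v|]; rewrite ?tensDr ?tens0r. Qed.

Lemma tens_delta i j :
  tens (r2v (delta_mx 0 i)) (r2v (delta_mx 0 j)) = delta_mx i j.
Proof. by rewrite /tens !r2vK trmx_delta mul_delta_mx. Qed.

Lemma tens_sumE x :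
  x = \sum_i \sum_j x i j *: tens (r2v (delta_mx 0 i)) (r2v (delta_mx 0 j)).
Proof.
rewrite [LHS]matrix_sum_delta; apply: eq_bigr => i _; apply: eq_bigr => j _.
by rewrite tens_delta.
Qed.

Lemma r2v_sumE (V : vectType K) (v : V) :
  v = \sum_i v2r v 0 i *: r2v (delta_mx 0 i).
Proof.
rewrite -[LHS]v2rK [in LHS](row_sum_delta (v2r v)) linear_sum /=.
by apply: eq_bigr => i _; rewrite linearZ.
Qed.

Lemma tens_mul_is_linear_l y : linear (tens_mul^~ y).
Proof.
move=> k x z; rewrite /tens_mul.
do 4![rewrite scaler_sumr -big_split /=; apply: eq_bigr => ? _].
by rewrite !mxE scalerA -scalerDl mulrDl mulrA.
Qed.

Lemma tens_mul_is_linear_r x : linear (tens_mul x).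
Proof.
move=> k y z; rewrite /tens_mul.
do 4![rewrite scaler_sumr -big_split /=; apply: eq_bigr => ? _].
by rewrite !mxE scalerA -scalerDl mulrDr mulrCA.
Qed.

Lemma tens_mulDl : left_distributive tens_mul +%R.
Proof.
by move=> x y z; have:= tens_mul_is_linear_l z 1 x y; rewrite !scale1r.
Qed.

Lemma tens_mulDr : right_distributive tens_mul +%R.
Proof.
by move=> x y z; have:= tens_mul_is_linear_r x 1 y z; rewrite !scale1r.
Qed.

Lemma tens_mul0l y : tens_mul 0 y = 0.
Proof. by apply: (addrI (tens_mul 0 y)); rewrite -tens_mulDl !addr0. Qed.

Lemma tens_mul0r x : tens_mul x 0 = 0.
Proof. by apply: (addrI (tens_mul x 0)); rewrite -tens_mulDr !addr0. Qed.

Lemma tens_mulZl k x y : tens_mul (k *: x) y = k *: tens_mul x y.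
Proof.
by have:= tens_mul_is_linear_l y k x 0; rewrite !addr0 tens_mul0l addr0.
Qed.

Lemma tens_mulZr k x y : tens_mul x (k *: y) = k *: tens_mul x y.
Proof.
by have:= tens_mul_is_linear_r x k y 0; rewrite !addr0 tens_mul0r addr0.
Qed.

Lemma tens_mulM a b c d : tens_mul (tens a b) (tens c d) = tens (a * c) (b * d).
Proof.
rewrite [in RHS](r2v_sumE a) [in RHS](r2v_sumE b) [in RHS](r2v_sumE c).
rewrite [in RHS](r2v_sumE d) !mulr_suml tens_suml /tens_mul.
apply: eq_bigr => i _; rewrite tens_sumr; apply: eq_bigr => j _.
rewrite !mulr_sumr tens_suml; apply: eq_bigr => k _.
rewrite tens_sumr; apply: eq_bigr => l _.
rewrite -!scalerAl -!scalerAr !(tensZl, tensZr) !scalerA.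
rewrite /tens !mxE !big_ord1 !mxE; congr (_ *: _); ring.
Qed.

Lemma tens_ind (P : tensor A B -> Prop) :
    P 0 -> (forall x y, P x -> P y -> P (x + y)) -> (forall a b, P (tens a b)) ->
  forall x, P x.
Proof.
move=> P0 PD Pt x; rewrite (tens_sumE x).
by do 2!elim/big_ind: _ => // ? _; rewrite -tensZl.
Qed.

Lemma tens_mulA : associative tens_mul.
Proof.
move=> x y z; elim/tens_ind: x => [|x x' IH IH'|a b].
- by rewrite !tens_mul0l.
- by rewrite !tens_mulDl IH IH'.
elim/tens_ind: y => [|y y' IH IH'|a' b'].
- by rewrite !(tens_mul0l, tens_mul0r).
- by rewrite !(tens_mulDl, tens_mulDr) IH IH'.
elim/tens_ind: z => [|z z' IH IH'|a'' b''].
- by rewrite !tens_mul0r.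
- by rewrite !tens_mulDr IH IH'.
by rewrite !tens_mulM !mulrA.
Qed.

Lemma tens_mul1l : left_id (tens 1 1) tens_mul.
Proof.
elim/tens_ind => [|x x' IH IH'|a b]; first exact: tens_mul0r.
  by rewrite tens_mulDr IH IH'.
by rewrite tens_mulM !mul1r.
Qed.

Lemma tens_mul1r : right_id (tens 1 1) tens_mul.
Proof.
elim/tens_ind => [|x x' IH IH'|a b]; first exact: tens_mul0l.
  by rewrite tens_mulDl IH IH'.
by rewrite tens_mulM !mulr1.
Qed.

Lemma tens_eq0 a b : (tens a b == 0) = (a == 0) || (b == 0).
Proof.
apply/eqP/orP => [t0|[/eqP->|/eqP->]]; rewrite ?tens0l ?tens0r //.
have [_|a0] := eqVneq a 0; [by left | right].
have /rV0Pn[i ai0] : v2r a != 0 by rewrite -(inj_eq (@v2r_inj K A)) linear0 in a0.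
rewrite -(inj_eq (@v2r_inj K B)) linear0; apply/eqP/rowP => j.
move/matrixP/(_ i j): t0; rewrite !mxE big_ord1 !mxE => /eqP.
by rewrite mulf_eq0 (negPf ai0) => /eqP.
Qed.

Lemma tens1_neq0 : tens 1 1 != 0.
Proof. by rewrite tens_eq0 !oner_eq0. Qed.

HB.instance Definition _ := GRing.Zmodule_isNzRing.Build (tensor A B)
  tens_mulA tens_mul1l tens_mul1r tens_mulDl tens_mulDr tens1_neq0.

Lemma tens_scaleAl k x y : k *: (x * y) = k *: x * y.
Proof. by rewrite [RHS]tens_mulZl. Qed.

HB.instance Definition _ :=
  GRing.Lmodule_isLalgebra.Build K (tensor A B) tens_scaleAl.

Lemma tens_scaleAr k x y : k *: (x * y) = x * (k *: y).
Proof. by rewrite [RHS]tens_mulZr. Qed.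

HB.instance Definition _ :=
  GRing.Lalgebra_isAlgebra.Build K (tensor A B) tens_scaleAr.

HB.instance Definition _ := Algebra_isFalgebra.Build K (tensor A B).

Lemma tensM a b c d : tens a b * tens c d = tens (a * c) (b * d).
Proof. exact: tens_mulM. Qed.

Lemma tens1 : tens 1 1 = 1 :> tensor A B.
Proof. by []. Qed.

End Tensor.

Record rank3_sita (C : numClosedFieldType) := Rank3Sita {
  sita_alg :> falgType C;
  sita_basis : 3.-tuple sita_alg;
  sita_lam (i j h : 'I_3) : C :=
    coord sita_basis h (tnth sita_basis i * tnth sita_basis j);
  sita_valency : 'AHom(sita_alg, C^o);
  sita_mulC : commutative (@GRing.mul sita_alg);
  sita_basisP : basis_of fullv sita_basis;
  sita_basis0 : tnth sita_basis 0 = 1;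
  (* in the order of C, 0 <= z says that z is real and nonnegative *)
  sita_lam_ge0 : forall i j h, 0 <= sita_lam i j h;
  sita_lam_neq0 : forall i j, i != j -> sita_lam i j 0 = 0;
  sita_lam_diag : forall i, exists m : nat, sita_lam i i 0 = m.+1%:R;
  sita_valencyE : forall i, sita_valency (tnth sita_basis i) = sita_lam i i 0
}.

Section Rank3.
Variable C : numClosedFieldType.

(* The algebra is commutative, so its irreducible characters are its unital
   algebra morphisms to C; chi enumerates all of them without repetition. *)
Definition character_table (A : rank3_sita C) (T : 'M[C]_3) :=
  exists chi : 'I_3 -> 'AHom(A, C^o),
    [/\ bijective chi, chi 0 = sita_valency A
      & forall i j, T i j = chi i (tnth (sita_basis A) j)].

Definition rank3_table (k l r s : C) : 'M[C]_3 :=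
  \matrix_(i < 3, j < 3) tnth (tnth [tuple [tuple 1; k; l];
                                           [tuple 1; r; -1 - r];
                                           [tuple 1; s; -1 - s]] i) j.

(* C_t = A_i (x) A_j for t = 3j + i + 1, with 1 <= t <= 9 *)
Definition tsq_basis (A : rank3_sita C) (t : nat) : tensor A A :=
  tens (sita_basis A)`_(t.-1 %% 3)%N (sita_basis A)`_(t.-1 %/ 3)%N.

Definition fusion_space (A : rank3_sita C) (tau : {set {set 'I_10}}) :
    {vspace tensor A A} :=
  <<tsq_basis A 1 :: [seq \sum_(t in T) tsq_basis A t | T : {set 'I_10} in tau]>>.

Definition gives_fusion (A : rank3_sita C) (tau : {set {set 'I_10}}) :=
  {in fusion_space A tau &, forall x y, x * y \in fusion_space A tau}.

End Rank3.

Definition idx29 : {set 'I_10} := [set t : 'I_10 | 2 <= t]%N.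

Definition coarsens (tau sigma : {set {set 'I_10}}) :=
  forall T, T \in tau ->
  exists2 P : {set {set 'I_10}}, P \subset sigma & T = cover P.

Definition part (bs : seq (seq nat)) : {set {set 'I_10}} :=
  [set:: [seq [set t : 'I_10 | (t : nat) \in b] | b <- bs]].

(* Main.v *)
From HB Require Import structures.
Require Import Defs.
From mathcomp Require Import all_boot all_order all_algebra all_field.
From mathcomp Require Import complex.
From mathcomp Require Import reals.
From mathcomp Require Import ring.

(* Write a = A_1, b = A_2 and J = 1 + a + b. The four blocks are the supports of
   a (x) 1, b (x) 1, J (x) a, J (x) b (factors exchanged in part 2), and a
   coarsening corresponds to one of the 15 partitions of these four elements.
   Since J a = k J, J b = l J and J J = (1 + k + l) J, their products are explicit
   in the structure constants of A, which depend only on k, l, al = lambda_121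
   and be = lambda_122. A partition gives a fusion iff the coefficient vectors
   that are constant on its blocks are stable under this product. For five
   partitions this is an identity, for three it amounts to lambda_112 = k - be = 0,
   for three to lambda_221 = l - al = 0, and for the last four it contradicts
   positivity. On the character table, k - be = 0 reads k = r, s = -1, and
   l - al = 0 reads l = -1 - s, r = 0; both fail for the Paley graph on 9 points. *)

Set Implicit Arguments.
Unset Strict Implicit.
Unset Printing Implicit Defensive.

Import Order.TTheory GRing.Theory Num.Theory.
Import VectorInternalTheory.

Local Open Scope ring_scope.

(** * Coarsenings *)

(** A coarsening of [bs] is encoded by a partition [ps] of the positions in [bs], so that both
    halves of the theorem reduce to the same partitions of four labels. *)
Definition blocks (bs ps : seq (seq nat)) :=
  [seq flatten [seq nth [::] bs i | i <- p] | p <- ps].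

Definition union_part bs ps : {set {set 'I_10}} := part (blocks bs ps).

(** Lists of blocks are compared up to order and repetition by booleans that evaluate on explicit
    data, which equality of finite sets does not. *)
Definition subblocks (ps qs : seq (seq nat)) :=
  all (fun p => has (perm_eq p) qs) ps.

Definition same_blocks ps qs := subblocks ps qs && subblocks qs ps.

Lemma mem_part (bs : seq (seq nat)) (T : {set 'I_10}) :
  reflect (exists2 b, b \in bs & T = [set t : 'I_10 | (t : nat) \in b])
          (T \in part bs).
Proof. by rewrite inE; apply: mapP. Qed.

Lemma sub_part ps qs : subblocks ps qs -> part ps \subset part qs.
Proof.
move/allP=> sub_pq; apply/subsetP => T /mem_part[p /sub_pq/hasP[q q_qs pq] ->].
by apply/mem_part; exists q => //; apply/setP => t; rewrite !inE (perm_mem pq).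
Qed.

Lemma part_eq ps qs : same_blocks ps qs -> part ps = part qs.
Proof. by case/andP=> pq qp; apply/eqP; rewrite eqEsubset !sub_part. Qed.

Definition same_parts (pss qss : seq (seq (seq nat))) :=
  all (fun ps => has (same_blocks ps) qss) pss
  && all (fun qs => has (same_blocks qs) pss) qss.

Lemma map_part_eq pss qss : same_parts pss qss -> map part pss =i map part qss.
Proof.
have sub L M : all (fun ps => has (same_blocks ps) M) L ->
    {subset map part L <= map part M}.
  move/allP=> LM _ /mapP[ps /LM/hasP[qs qs_M /part_eq->] ->]; exact: map_f.
by case/andP=> /sub pq /sub qp x; apply/idP/idP; [apply: pq | apply: qp].
Qed.

Lemma subblocks_union bs ps qs :
  subblocks ps qs -> subblocks (blocks bs ps) (blocks bs qs).
Proof.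
move/allP=> sub_pq; apply/allP => _ /mapP[p /sub_pq/hasP[q q_qs pq] ->].
apply/hasP; exists (flatten [seq nth [::] bs i | i <- q]).
  by apply/mapP; exists q.
exact/perm_flatten/perm_map.
Qed.

Lemma union_part_eq bs ps qs :
  same_blocks ps qs -> union_part bs ps = union_part bs qs.
Proof.
by case/andP=> pq qp; apply: part_eq; rewrite /same_blocks !subblocks_union.
Qed.

Lemma block_of_uniq (T : eqType) (bs : seq (seq T)) b c t :
  uniq (flatten bs) -> b \in bs -> c \in bs -> t \in b -> t \in c -> b = c.
Proof.
elim: bs => //= d ds IH; rewrite cat_uniq => /and3P[_ /hasPn dis /IH{}IH].
have {}dis e : e \in ds -> t \in e -> t \notin d.
  by move=> e_ds t_e; apply: dis; apply/flattenP; exists e.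
rewrite !inE => /predU1P[->|b_ds] /predU1P[->|c_ds] // t_b t_c.
- by case/negP: (dis c c_ds t_c).
- by case/negP: (dis b b_ds t_b).
exact: IH.
Qed.

Lemma uniq_block (T : eqType) (bs : seq (seq T)) b :
  uniq (flatten bs) -> b \in bs -> uniq b.
Proof.
elim: bs => //= d ds IH; rewrite cat_uniq => /and3P[u_d _ /IH{}IH].
by rewrite inE => /predU1P[->|/IH].
Qed.

Section Coarsening.
Variables (bs : seq (seq nat)) (tau : {set {set 'I_10}}).
Hypotheses (bs_perm : perm_eq (flatten bs) (iota 2 8)) (bs_nil : [::] \notin bs).
Hypotheses (tauP : partition tau idx29) (tau_bs : coarsens tau (part bs)).

(** Each block is represented by its first element; [bs_nil] excludes the default 0, and all
    elements are below 10, so [inord] does not change them. *)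
Let rep i : 'I_10 := inord (head 0%N (nth [::] bs i)).
Let blk i := pblock tau (rep i).

Lemma mem_flatten_block b t : b \in bs -> t \in b -> t \in iota 2 8.
Proof. by move=> b_bs t_b; rewrite -(perm_mem bs_perm); apply/flattenP; exists b. Qed.

Lemma rep_mem i : (i < size bs)%N -> (rep i : nat) \in nth [::] bs i.
Proof.
move=> lt_i; have b_bs := mem_nth [::] lt_i; rewrite /rep.
case Eb: (nth [::] bs i) b_bs => [|t b] b_bs; first by move: (bs_nil); rewrite b_bs.
have := mem_flatten_block b_bs (mem_head t b).
by rewrite mem_iota /= => /andP[_ lt_t]; rewrite inordK ?mem_head.
Qed.

Lemma idx29E (t : 'I_10) : (t \in idx29) = ((t : nat) \in flatten bs).
Proof. by rewrite (perm_mem bs_perm) inE mem_iota ltn_ord andbT. Qed.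

(** The block of [tau] around [t] is a union of blocks of [bs]. One of these contains [t], hence by
    disjointness is the [i]-th one, and so the union also contains [rep i]. *)
Lemma pblock_blk i (t : 'I_10) :
  (i < size bs)%N -> (t : nat) \in nth [::] bs i -> pblock tau t = blk i.
Proof.
move=> lt_i t_b; have [/eqP covT trivT _] := and3P tauP.
have b_bs := mem_nth [::] lt_i.
have t_cov : t \in cover tau.
  by rewrite covT idx29E; apply/flattenP; exists (nth [::] bs i).
have T_tau := pblock_mem t_cov; have := t_cov; rewrite -mem_pblock.
case: (tau_bs T_tau) => P sPbs ET; rewrite {1}ET => /bigcupP[Q QP tQ].
have /mem_part[c c_bs EQ] := subsetP sPbs Q QP.
have Ec: c = nth [::] bs i.
  have u_bs : uniq (flatten bs) by rewrite (perm_uniq bs_perm) iota_uniq.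
  by apply: (block_of_uniq u_bs c_bs b_bs _ t_b); rewrite EQ inE in tQ.
apply/esym/(def_pblock trivT T_tau); rewrite ET; apply/bigcupP; exists Q => //.
by rewrite EQ Ec inE rep_mem.
Qed.

Lemma blk_tau i : (i < size bs)%N -> blk i \in tau.
Proof.
move=> lt_i; have [/eqP covT _ _] := and3P tauP.
apply: pblock_mem; rewrite covT idx29E; apply/flattenP.
by exists (nth [::] bs i); [apply: mem_nth | apply: rep_mem].
Qed.

Lemma mem_idx29 (t : 'I_10) :
  t \in idx29 -> exists2 i, (i < size bs)%N & (t : nat) \in nth [::] bs i.
Proof.
by rewrite idx29E => /flattenP[b /(nthP [::])[i lt_i <-]]; exists i.
Qed.

Lemma blkE i : (i < size bs)%N ->
  blk i = [set t : 'I_10 | (t : nat) \in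
    flatten [seq nth [::] bs j | j <- [seq j <- iota 0 (size bs) | blk i == blk j]]].
Proof.
move=> lt_i; have [/eqP covT trivT _] := and3P tauP.
apply/setP => t; rewrite inE; apply/idP/flattenP.
  move=> t_T; have /mem_idx29[j lt_j t_j] : t \in idx29.
    by rewrite -covT; apply/bigcupP; exists (blk i); rewrite ?blk_tau.
  exists (nth [::] bs j) => //; apply/mapP; exists j => //.
  rewrite mem_filter mem_iota lt_j andbT -(pblock_blk lt_j t_j).
  by rewrite (def_pblock trivT (blk_tau lt_i) t_T) eqxx.
case=> _ /mapP[j + ->]; rewrite mem_filter mem_iota => /andP[/eqP-> lt_j] t_j.
rewrite -(pblock_blk lt_j t_j) mem_pblock covT idx29E.
by apply/flattenP; exists (nth [::] bs j); rewrite ?mem_nth.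
Qed.

(** The encoding of [tau] is the kernel of [blk] on positions. A class is listed once for each of
    its members, which is harmless because [part] forms a set. *)
Lemma coarsens_union_part :
  tau = union_part bs [seq [seq j <- iota 0 (size bs) | blk i == blk j]
                         | i <- iota 0 (size bs)].
Proof.
have [/eqP covT trivT tau0] := and3P tauP.
apply/setP => T; apply/idP/mem_part.
  move=> T_tau; have [T0|[t t_T]] := set_0Vmem T; first by rewrite -T0 T_tau in tau0.
  have /mem_idx29[i lt_i t_i] : t \in idx29 by rewrite -covT; apply/bigcupP; exists T.
  eexists; last first.
    by rewrite -(def_pblock trivT T_tau t_T) (pblock_blk lt_i t_i) (blkE lt_i).
  by rewrite /blocks -map_comp; apply/mapP; exists i; rewrite // mem_iota.
case=> _ /mapP[_ /mapP[i + ->] ->] ->; rewrite mem_iota => lt_i.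
by rewrite -blkE ?blk_tau.
Qed.

End Coarsening.

(* Partitions of the labels 0, 1, 2, 3 of the four blocks, which stand for
   a (x) 1, b (x) 1, J (x) a and J (x) b with J = 1 + a + b (or for the same
   elements with the two factors exchanged). *)
Definition always_parts : seq (seq (seq nat)) :=
  [:: [:: [:: 0]; [:: 1]; [:: 2]; [:: 3]];
      [:: [:: 0]; [:: 1]; [:: 2; 3]];
      [:: [:: 0; 1]; [:: 2]; [:: 3]];
      [:: [:: 0; 1]; [:: 2; 3]];
      [:: [:: 0; 1; 2; 3]]]%N.

Definition mu_parts : seq (seq (seq nat)) :=
  [:: [:: [:: 0]; [:: 1; 2; 3]];
      [:: [:: 0; 1; 2]; [:: 3]];
      [:: [:: 0]; [:: 1; 2]; [:: 3]]]%N.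

Definition ga_parts : seq (seq (seq nat)) :=
  [:: [:: [:: 0; 2; 3]; [:: 1]];
      [:: [:: 0; 1; 3]; [:: 2]];
      [:: [:: 0; 3]; [:: 1]; [:: 2]]]%N.

Definition never_parts : seq (seq (seq nat)) :=
  [:: [:: [:: 0; 2]; [:: 1]; [:: 3]];
      [:: [:: 1; 3]; [:: 0]; [:: 2]];
      [:: [:: 0; 2]; [:: 1; 3]];
      [:: [:: 0; 3]; [:: 1; 2]]]%N.

Definition all_parts := always_parts ++ mu_parts ++ ga_parts ++ never_parts.

(** The kernel of [f] on four labels is determined by six booleans, and each consistent valuation is
    settled by evaluation. *)
Lemma all_partsP (T : eqType) (f : nat -> T) :
  exists2 ps, ps \in all_parts &
    same_blocks [seq [seq j <- iota 0 4 | f i == f j] | i <- iota 0 4] ps.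
Proof.
apply/hasP; rewrite /= !eqxx [f 1 == f 0]eq_sym [f 2 == f 0]eq_sym [f 3 == f 0]eq_sym.
rewrite [f 2 == f 1]eq_sym [f 3 == f 1]eq_sym [f 3 == f 2]eq_sym.
(* The three forms of transitivity say that no triple has exactly two equal pairs; this leaves 15 of
   the 64 valuations. *)
have tr i j h : (f i == f j) && (f j == f h) ==> (f i == f h).
  by apply/implyP => /andP[/eqP-> /eqP->].
have tl i j h : (f i == f j) && (f i == f h) ==> (f j == f h).
  by apply/implyP => /andP[/eqP-> /eqP->].
have tm i j h : (f i == f h) && (f j == f h) ==> (f i == f j).
  by apply/implyP => /andP[/eqP-> /eqP->].
move: (tr 0 1 2) (tr 0 1 3) (tr 0 2 3) (tr 1 2 3) => {tr}.
move: (tl 0 1 2) (tl 0 1 3) (tl 0 2 3) (tl 1 2 3) => {tl}.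
move: (tm 0 1 2) (tm 0 1 3) (tm 0 2 3) (tm 1 2 3) => {tm}.
by case: (f 0 == f 1); case: (f 0 == f 2); case: (f 0 == f 3);
   case: (f 1 == f 2); case: (f 1 == f 3); case: (f 2 == f 3).
Qed.

(** * Structure constants and eigenvalues *)

Section Degeneracy.
Variables (C : numFieldType) (k l al be : C).
Hypotheses (k0 : 0 < k) (l0 : 0 < l) (muE : (k - be) * l = al * k).

(** By [muE], lambda_112 = k - be and lambda_121 = al are positive multiples of each other. *)
Lemma mu_eq0_al : be = k <-> al = 0.
Proof.
split=> E; have /eqP := muE; rewrite E.
  by rewrite subrr mul0r eq_sym mulf_eq0 (gt_eqF k0) orbF => /eqP.
by rewrite mul0r mulf_eq0 (gt_eqF l0) orbF subr_eq0 => /eqP.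
Qed.

(** Rearranged, [muE] reads (l - al) k = be l, the same relation for lambda_221 and lambda_122. *)
Lemma ga_eq0_be : al = l <-> be = 0.
Proof.
split=> E; last by apply: (mulIf (lt0r_neq0 k0)); rewrite -muE E subr0 mulrC.
have /eqP := muE; rewrite E [l * k]mulrC mulrBl subr_eq addrC -subr_eq subrr.
by rewrite eq_sym mulf_eq0 (gt_eqF l0) orbF => /eqP.
Qed.

End Degeneracy.

Section Structure.
Variable C : numClosedFieldType.

Local Notation o1 := (@Ordinal 3 1 isT).
Local Notation o2 := (@Ordinal 3 2 isT).

(* al and be are the structure constants lambda_121 and lambda_122; associativity
   and the valency express the others in terms of them, and int_muE is
   lambda_112 * l = lambda_121 * k. *)
Record intersection_numbers (A : rank3_sita C) (k l al be : C) : Prop := {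
  int_kgt0 : 0 < k;
  int_lgt0 : 0 < l;
  int_be : 0 <= be;
  int_ga : 0 <= l - al;
  int_muE : (k - be) * l = al * k;
  int_11 : (sita_basis A)`_1 * (sita_basis A)`_1 =
    k *: 1 + (k - 1 - al) *: (sita_basis A)`_1 + (k - be) *: (sita_basis A)`_2;
  int_12 : (sita_basis A)`_1 * (sita_basis A)`_2 =
    al *: (sita_basis A)`_1 + be *: (sita_basis A)`_2;
  int_22 : (sita_basis A)`_2 * (sita_basis A)`_2 =
    l *: 1 + (l - al) *: (sita_basis A)`_1 + (l - 1 - be) *: (sita_basis A)`_2
}.

Lemma sita_basis1 (A : rank3_sita C) : (sita_basis A)`_0 = 1.
Proof. by rewrite -(sita_basis0 A) (tnth_nth 0). Qed.

Lemma sita_mulE (A : rank3_sita C) (i j : 'I_3) :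
  (sita_basis A)`_i * (sita_basis A)`_j =
  sita_lam A i j 0 *: 1 + sita_lam A i j o1 *: (sita_basis A)`_1
  + sita_lam A i j o2 *: (sita_basis A)`_2.
Proof.
rewrite [LHS](coord_basis (sita_basisP A) (memvf _)) !big_ord_recl big_ord0 addr0.
rewrite /= sita_basis1 addrA /sita_lam !(tnth_nth 0).
by congr (_ *: _ + _ *: _ + _ *: _); congr (coord _ _ _); apply: val_inj.
Qed.

Section Table.
Variables (A : rank3_sita C) (k l r s : C).
Hypotheses (tab : character_table A (rank3_table k l r s)) (le_sr : s <= r).
Local Notation a := (sita_basis A)`_1.
Local Notation b := (sita_basis A)`_2.

Lemma table_chars : exists chi : 'I_3 -> 'AHom(A, C^o),
  [/\ injective chi, chi 0 =1 sita_valency A,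
      forall i, chi i a = nth 0 [:: k; r; s] i &
      forall i, chi i b = nth 0 [:: l; -1 - r; -1 - s] i].
Proof.
case: tab => chi [/bij_inj chi_inj chi0 chiE]; exists chi; split=> // [x|i|i].
- by rewrite chi0.
- have := chiE i o1; rewrite mxE !(tnth_nth 0) => <-.
  by case: i => [[|[|[|//]]]] ?.
have := chiE i o2; rewrite mxE !(tnth_nth 0) => <-.
by case: i => [[|[|[|//]]]] ?.
Qed.

(** If r = s, the last two rows of the table coincide, so two distinct characters would agree on a
    basis. *)
Lemma table_rs_neq : r != s.
Proof.
have [chi [chi_inj _ chia chib]] := table_chars.
apply/eqP => rs; have /chi_inj : chi o1 = chi o2; last by [].
apply/val_inj/lfunP => x; rewrite (coord_basis (sita_basisP A) (memvf x)).
rewrite !linear_sum; apply: eq_bigr => i _; rewrite !linearZ; congr (_ *: _).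
case: i => [[|[|[|//]]]] ? /=; rewrite ?sita_basis1 ?rmorph1 //.
  by rewrite !chia /= rs.
by rewrite !chib /= rs.
Qed.

(** Comparing the coefficient of 1 in a (a b) = (a a) b and in a (b b) = (a b) b gives mu l = al k
    and ga k = be l. The valencies of a a, a b and b b then determine lam, mu, ga and de. *)
Lemma table_intersection_numbers :
  exists al be, intersection_numbers A k l al be.
Proof.
have [chi [_ chi0 chia chib]] := table_chars.
have Ek : k = sita_lam A o1 o1 0 :> C.
  by rewrite -sita_valencyE -chi0 (tnth_nth 0) chia.
have El : l = sita_lam A o2 o2 0 :> C.
  by rewrite -sita_valencyE -chi0 (tnth_nth 0) chib.
have k0 : 0 < k by rewrite Ek; have [m ->] := sita_lam_diag A o1; rewrite ltr0n.
have l0 : 0 < l by rewrite El; have [m ->] := sita_lam_diag A o2; rewrite ltr0n.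
have aa := sita_mulE A o1 o1; have ab := sita_mulE A o1 o2.
have bb := sita_mulE A o2 o2.
have ab0 : sita_lam A o1 o2 0 = 0 by apply: sita_lam_neq0.
rewrite -Ek in aa; rewrite -El in bb; rewrite ab0 scale0r add0r in ab.
have := sita_lam_ge0 A o2 o2 o1; have := sita_lam_ge0 A o1 o2 o2.
move: aa ab bb => /=.
set lam := sita_lam A o1 o1 o1; set mu := sita_lam A o1 o1 o2.
set al := sita_lam A o1 o2 o1; set be := sita_lam A o1 o2 o2.
set ga := sita_lam A o2 o2 o1; set de := sita_lam A o2 o2 o2.
move=> aa ab bb be0 ga0.
have fr := basis_free (sita_basisP A).
pose c0 := coord (sita_basis A) 0.
have c0D x y : c0 (x + y) = c0 x + c0 y by exact: linearD.
have c0Z x y : c0 (x *: y) = x * c0 y by exact: linearZ.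
have c01 : c0 1 = 1 by rewrite -[X in c0 X](sita_basis1 A) /c0 /= (coord_free 0 0 fr).
have c0a : c0 a = 0 by rewrite /c0 /= (coord_free o1 0 fr).
have c0b : c0 b = 0 by rewrite /c0 /= (coord_free o2 0 fr).
have mul_al : mu * l = al * k.
  have := congr1 c0 (mulrA a a b); rewrite ab aa mulrDr !mulrDl -!scalerAr -!scalerAl.
  rewrite mul1r ab aa bb !(c0D, c0Z) c01 c0a c0b.
  move=> /eqP E; apply/eqP; rewrite -subr_eq0; apply/eqP.
  by move: E; rewrite -subr_eq0 => /eqP E; rewrite -[RHS]oppr0 -[in RHS]E; ring.
have ga_be : ga * k = be * l.
  have := congr1 c0 (mulrA a b b); rewrite ab bb !mulrDr !mulrDl -!scalerAr -!scalerAl.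
  rewrite mulr1 ab aa bb !(c0D, c0Z) c01 c0a c0b.
  move=> /eqP E; apply/eqP; rewrite -subr_eq0; apply/eqP.
  by move: E; rewrite -subr_eq0 => /eqP E; rewrite -[RHS]E; ring.
move: (congr1 (chi 0) aa) (congr1 (chi 0) ab) (congr1 (chi 0) bb); rewrite !rmorphM !linearD !linearZ /= rmorph1 !chia !chib /=.
rewrite /GRing.scale /= => vaa vab vbb.
have lamE : lam = k - 1 - al.
  apply: (mulIf (lt0r_neq0 k0)); rewrite !mulrBl vaa -mul_al; ring.
have muE : mu = k - be.
  by apply: (mulIf (lt0r_neq0 l0)); rewrite mulrBl vab mul_al; ring.
have gaE : ga = l - al.
  by apply: (mulIf (lt0r_neq0 k0)); rewrite mulrBl ga_be [l * k]mulrC vab; ring.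
have deE : de = l - 1 - be.
  by apply: (mulIf (lt0r_neq0 l0)); rewrite !mulrBl vbb ga_be; ring.
exists al, be; split=> //; rewrite -?muE -?gaE //.
- by rewrite aa lamE.
- by rewrite bb deE.
Qed.

Section Eigenvalues.
Variables al be : C.
Hypothesis num : intersection_numbers A k l al be.

Let k0 := int_kgt0 num.
Let l0 := int_lgt0 num.

(** These are the images of the products a a and b b under a character with values x at a and -1 - x
    at b. *)
Lemma eigenvalue_eq x : x \in [:: r; s] ->
  x ^+ 2 = k + (k - 1 - al) * x + (k - be) * (-1 - x) /\
  (-1 - x) ^+ 2 = l + (l - al) * x + (l - 1 - be) * (-1 - x).
Proof.
have [chi [_ _ chia chib]] := table_chars.
move=> xrs; have [i [Ea Eb]] : exists i, chi i a = x /\ chi i b = -1 - x.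
  move: xrs; rewrite !inE => /orP[]/eqP->; [exists o1 | exists o2];
  by rewrite chia chib.
have := congr1 (chi i) (int_11 num); have := congr1 (chi i) (int_22 num).
rewrite !rmorphM !linearD !linearZ /= rmorph1 Ea Eb /GRing.scale /= !mulr1 => x_b x_a.
by rewrite !expr2; split.
Qed.

(** If be = k, then al = 0 and the equation of the eigenvalues is (x - k)(x + 1) = 0; as r and s are
    distinct and s <= r, they are k and -1. Conversely, the equation at k = r becomes (k - be)(1 + k
    + l) = 0, with positive second factor. *)
Lemma mu_eq0P : be = k <-> k = r /\ s = -1.
Proof.
have [r_eq _] := eigenvalue_eq (mem_head r [:: s]).
split=> [Ebe|[Ek _]]; last first.
  have E : (k - be) * (1 + k + l) = 0.
    have := int_muE num; move: r_eq; rewrite -Ek => r_eq E.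
    rewrite mulrDr E; move/eqP: r_eq; rewrite -subr_eq0 => /eqP r_eq.
    by rewrite -[RHS]r_eq; ring.
  have /eqP := E; rewrite mulf_eq0 subr_eq0 orbC gt_eqF ?ltr_wpDl ?addr_ge0 ?ltW //=.
  by move/eqP->.
have al0 : al = 0 by apply/(mu_eq0_al k0 l0 (int_muE num)).
have root x : x \in [:: r; s] -> (x == k) || (x == -1).
  case/eigenvalue_eq=> x_eq _; rewrite -[x == k]subr_eq0 -[x == -1]subr_eq0 -mulf_eq0.
  rewrite opprK; move/eqP: x_eq; rewrite -subr_eq0 Ebe al0 => /eqP x_eq.
  by rewrite -x_eq; apply/eqP; ring.
have := table_rs_neq; have := le_sr.
have s_rs : s \in [:: r; s] by rewrite !inE eqxx orbT.
case/orP: (root r (mem_head r [:: s])) => /eqP->; case/orP: (root s s_rs) => /eqP->.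
- by rewrite eqxx.
- by [].
- by move=> /(lt_le_trans k0); rewrite oppr_gt0 ltr10.
- by rewrite eqxx.
Qed.

(** The same argument with a and b exchanged: if al = l, the values y = -1 - x at b satisfy (y -
    l)(y + 1) = 0, and x = 0 corresponds to y = -1. *)
Lemma ga_eq0P : al = l <-> l = -1 - s /\ r = 0.
Proof.
have s_rs : s \in [:: r; s] by rewrite !inE eqxx orbT.
split=> [Eal|[El _]]; last first.
  have [_ s_eq] := eigenvalue_eq s_rs.
  have E : (l - al) * (1 + k + l) = 0.
    have := int_muE num; move: s_eq; rewrite -El => s_eq E.
    have -> : 1 + k + l = k - s by rewrite El; ring.
    move/eqP: s_eq; rewrite -subr_eq0 => /eqP s_eq.
    move/eqP: E; rewrite -subr_eq0 => /eqP E.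
    transitivity (((k - be) * l - al * k)
      + (l ^+ 2 - (l + (l - al) * s + (l - 1 - be) * l))); first by ring.
    by rewrite E s_eq addr0.
  have /eqP := E; rewrite mulf_eq0 subr_eq0 orbC gt_eqF ?ltr_wpDl ?addr_ge0 ?ltW //=.
  by move/eqP->.
have be0 : be = 0 by apply/(ga_eq0_be k0 l0 (int_muE num)).
have root x : x \in [:: r; s] -> (-1 - x == l) || (x == 0).
  case/eigenvalue_eq=> _ x_eq; rewrite -[-1 - x == l]subr_eq0 -mulf_eq0.
  move/eqP: x_eq; rewrite -subr_eq0 Eal be0 => /eqP x_eq.
  by apply/eqP/oppr_inj; rewrite oppr0 -[RHS]x_eq; ring.
have rs_neq := table_rs_neq; have le := le_sr.
have Ex x : -1 - x = l -> x = -1 - l by move=> <-; ring.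
case/orP: (root r (mem_head r [:: s])) => /eqP Er; case/orP: (root s s_rs) => /eqP Es.
- by rewrite (Ex r Er) (Ex s Es) eqxx in rs_neq.
- move: le; rewrite (Ex r Er) Es -opprD oppr_ge0 => /(lt_le_trans (addr_gt0 ltr01 l0)).
  by rewrite ltxx.
- by rewrite Es.
- by rewrite Er Es eqxx in rs_neq.
Qed.

End Eigenvalues.
End Table.
End Structure.

(* The scheme of the Paley graph on 9 points, with k = l = 4, r = 1 and s = -2,
   realised as C^3 with its pointwise product via the rows of its table: here
   neither k = r nor r = 0. *)
Section Paley.
Variable C : numClosedFieldType.

Definition cube := (C^o * C^o * C^o)%type.
HB.instance Definition _ := Vector.on cube.
HB.instance Definition _ := GRing.Algebra.on cube.
HB.instance Definition _ := Algebra_isFalgebra.Build C cube.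

Definition cube_proj0 (u : cube) : C^o := u.1.1.
Definition cube_proj1 (u : cube) : C^o := u.1.2.
Definition cube_proj2 (u : cube) : C^o := u.2.
HB.instance Definition _ := GRing.LRMorphism.copy cube_proj0 (fst \o fst : cube -> C^o).
HB.instance Definition _ := GRing.LRMorphism.copy cube_proj1 (snd \o fst : cube -> C^o).
HB.instance Definition _ := GRing.LRMorphism.copy cube_proj2 (snd : cube -> C^o).
Definition cube_char (i : 'I_3) : 'AHom(cube, C^o) :=
  nth (linfun_ahom cube_proj0)
    [:: linfun_ahom cube_proj0; linfun_ahom cube_proj1; linfun_ahom cube_proj2] i.
Definition paley_basis : 3.-tuple cube :=
  [tuple (1, 1, 1); (4%:R, 1, - 2%:R); (4%:R, - 2%:R, 1)].
Lemma dim_cube : \dim {:cube} = 3.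
Proof. by rewrite dimvf. Qed.

Definition paley_lam (i j h : 'I_3) : nat :=
  nth 0 (nth [::] (nth [::]
    [:: [:: [:: 1; 0; 0]; [:: 0; 1; 0]; [:: 0; 0; 1]];
        [:: [:: 0; 1; 0]; [:: 4; 1; 2]; [:: 0; 2; 2]];
        [:: [:: 0; 0; 1]; [:: 0; 2; 2]; [:: 4; 2; 1]]] i) j) h.

Lemma cubeP (u v : cube) : (forall i, cube_char i u = cube_char i v) -> u = v.
Proof.
case: u v => [[u0 u1] u2] [[v0 v1] v2] E.
have := E 0; have := E 1; have := E 2; rewrite /cube_char /= !lfunE /=.
by rewrite /cube_proj0 /cube_proj1 /cube_proj2 /= => -> -> ->.
Qed.

Definition paley_table : 'M[C]_3 := rank3_table 4%:R 4%:R 1 (- 2%:R).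

Lemma cube_char_basis i j : cube_char i (tnth paley_basis j) = paley_table i j.
Proof.
rewrite /cube_char mxE !(tnth_nth 0).
case: i => [[|[|[|//]]]] ?; case: j => [[|[|[|//]]]] ?; rewrite /= lfunE //=;
rewrite /cube_proj0 /cube_proj1 /cube_proj2 /=; ring.
Qed.

(** The Paley scheme is self-dual, so its table is its own inverse up to the number of points. *)
Lemma paley_tableK : paley_table *m paley_table = 9%:R%:M.
Proof.
apply/matrixP => i j; rewrite !mxE !big_ord_recl big_ord0 !mxE !(tnth_nth 0).
by case: i => [[|[|[|//]]]] ?; case: j => [[|[|[|//]]]] ?; rewrite /= ; ring.
Qed.

Lemma paley_mul (i j : 'I_3) : tnth paley_basis i * tnth paley_basis j =
  \sum_h (paley_lam i j h)%:R *: tnth paley_basis h.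
Proof.
apply: cubeP => h; rewrite rmorphM linear_sum /= !cube_char_basis.
under eq_bigr do rewrite linearZ /= cube_char_basis.
rewrite !big_ord_recl big_ord0 !mxE !(tnth_nth 0).
by case: i => [[|[|[|//]]]] ?; case: j => [[|[|[|//]]]] ?; case: h => [[|[|[|//]]]] ?;
  rewrite /= /paley_lam /= /GRing.scale /=; ring.
Qed.

(** Applying the characters to a relation gives a row killed by the transposed table; multiplying by
    that matrix once more gives 9 times the row. *)
Lemma paley_free : free paley_basis.
Proof.
apply/freeP => c c0 i.
have c_tab : \row_j c j *m paley_table^T = 0.
  apply/rowP => h; rewrite !mxE -[RHS](linear0 (cube_char h)) -c0 linear_sum.
  by apply: eq_bigr => j _; rewrite !mxE linearZ /= -tnth_nth cube_char_basis mxE.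
have /rowP/(_ i) : \row_j c j *m paley_table^T *m paley_table^T = 0.
  by rewrite c_tab mul0mx.
rewrite -mulmxA -trmx_mul paley_tableK tr_scalar_mx mul_mx_scalar !mxE => /eqP.
by rewrite mulf_eq0 pnatr_eq0 => /eqP.
Qed.

Lemma paley_basisP : basis_of fullv paley_basis.
Proof. by rewrite basisEfree paley_free subvf dim_cube size_tuple. Qed.

Lemma paley_lamE i j h :
  coord paley_basis h (tnth paley_basis i * tnth paley_basis j) = (paley_lam i j h)%:R.
Proof.
rewrite paley_mul; under eq_bigr do rewrite (tnth_nth 0).
by rewrite coord_sum_free ?paley_free.
Qed.

Lemma cube_mulC : commutative (@GRing.mul cube).
Proof. by move=> [[u0 u1] u2] [[v0 v1] v2]; congr (_, _, _); apply: mulrC. Qed.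

(** The primitive idempotents [e i] sum to 1, so a character [f] is nonzero at one of them, and f(u)
    f(e_i) = chi_i(u) f(e_i) then forces f = chi_i. The inverse picks such an index; its default is
    never reached. *)
Lemma cube_char_bij : bijective cube_char.
Proof.
pose e (i : 'I_3) : cube := ((i == 0)%:R : C, (i == 1)%:R : C, (i == 2)%:R : C).
have char_e (i j : 'I_3) : cube_char i (e j) = (i == j)%:R.
  case: i => [[|[|[|//]]]] ?; case: j => [[|[|[|//]]]] ?;
  by rewrite /cube_char /= lfunE.
have mul_e (u : cube) i : u * e i = cube_char i u *: e i.
  apply: cubeP => h; rewrite rmorphM linearZ /= char_e.
  by case: eqVneq => [->|_] //; rewrite /GRing.scale /= !mulr0.
have sum_e : \sum_i e i = 1.
  apply: cubeP => h; rewrite linear_sum /= rmorph1.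
  under eq_bigr do rewrite char_e.
  by rewrite (bigD1 h) //= eqxx big1 ?addr0 // => i; rewrite eq_sym => /negPf->.
exists (fun f : 'AHom(cube, C^o) => odflt 0 [pick i | f (e i) != 0]) => [i|f].
  case: pickP => [j|/(_ i)]; rewrite char_e; last by rewrite eqxx oner_eq0.
  by rewrite pnatr_eq0 eqb0 negbK => /eqP->.
case: pickP => [i fi|f0]; last first.
  have /eqP : f (\sum_i e i) = 1 by rewrite sum_e rmorph1.
  rewrite linear_sum big1 => [|i _].
    by rewrite eq_sym oner_eq0.
  by apply/eqP; rewrite -[_ == _]negbK f0.
apply/val_inj/lfunP => u; apply: (mulIf fi).
by have := congr1 f (mul_e u i); rewrite rmorphM linearZ.
Qed.

Lemma paley_lam_diag i : exists m : nat,
  coord paley_basis 0 (tnth paley_basis i * tnth paley_basis i) = m.+1%:R.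
Proof.
exists (paley_lam i i 0).-1; rewrite paley_lamE; congr _%:R.
by case: i => [[|[|[|//]]]] ?.
Qed.

Lemma paley_lam_neq0 i j : i != j ->
  coord paley_basis 0 (tnth paley_basis i * tnth paley_basis j) = 0.
Proof.
rewrite paley_lamE.
by case: i => [[|[|[|//]]]] ?; case: j => [[|[|[|//]]]] ?.
Qed.

Lemma paley_valencyE i : cube_char 0 (tnth paley_basis i) =
  coord paley_basis 0 (tnth paley_basis i * tnth paley_basis i).
Proof.
rewrite paley_lamE cube_char_basis mxE.
by case: i => [[|[|[|//]]]] ?; rewrite !(tnth_nth 0).
Qed.

Lemma paley_lam_ge0 i j h :
  0 <= coord paley_basis h (tnth paley_basis i * tnth paley_basis j).
Proof. by rewrite paley_lamE ler0n. Qed.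

Definition paley : rank3_sita C :=
  Rank3Sita cube_mulC paley_basisP erefl paley_lam_ge0 paley_lam_neq0
    paley_lam_diag paley_valencyE.

Lemma paley_character_table : character_table paley paley_table.
Proof.
by exists cube_char; split=> // [|i j]; [apply: cube_char_bij | rewrite -cube_char_basis].
Qed.
End Paley.

(** * Fusions of the wreath product *)

Section WreathFusion.
Variable C : numClosedFieldType.
Variables k l al be : C.
Local Notation n := (1 + k + l).

(* Structure constants for the basis 1, a (x) 1, b (x) 1, J (x) a, J (x) b;
   the missing entries of the inner lists are 0. *)
Definition wreath_coef (i j h : nat) : C :=
  nth 0 (nth [::] (nth [::]
    [:: [:: [:: 1]; [:: 0; 1]; [:: 0; 0; 1]; [:: 0; 0; 0; 1]; [:: 0; 0; 0; 0; 1]];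
        [:: [:: 0; 1]; [:: k; k - 1 - al; k - be]; [:: 0; al; be];
            [:: 0; 0; 0; k]; [:: 0; 0; 0; 0; k]];
        [:: [:: 0; 0; 1]; [:: 0; al; be]; [:: l; l - al; l - 1 - be];
            [:: 0; 0; 0; l]; [:: 0; 0; 0; 0; l]];
        [:: [:: 0; 0; 0; 1]; [:: 0; 0; 0; k]; [:: 0; 0; 0; l];
            [:: n * k; n * k; n * k; n * (k - 1 - al); n * (k - be)];
            [:: 0; 0; 0; n * al; n * be]];
        [:: [:: 0; 0; 0; 0; 1]; [:: 0; 0; 0; 0; k]; [:: 0; 0; 0; 0; l];
            [:: 0; 0; 0; n * al; n * be];
            [:: n * l; n * l; n * l; n * (l - al); n * (l - 1 - be)]]] i) j) h.

Definition wreath_prod (c d : nat -> C) (h : nat) : C :=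
  \sum_(i < 5) \sum_(j < 5) c i * d j * wreath_coef i j h.

Lemma wreath_prod1 c d : wreath_prod c d 1 =
  c 0%N * d 1%N + c 1%N * d 0%N + (k - 1 - al) * (c 1%N * d 1%N)
  + al * (c 1%N * d 2%N + c 2%N * d 1%N) + (l - al) * (c 2%N * d 2%N)
  + n * k * (c 3%N * d 3%N) + n * l * (c 4%N * d 4%N).
Proof.
by rewrite /wreath_prod !big_ord_recl !big_ord0 /wreath_coef /bump /=; ring.
Qed.

Lemma wreath_prod2 c d : wreath_prod c d 2 =
  c 0%N * d 2%N + c 2%N * d 0%N + (k - be) * (c 1%N * d 1%N)
  + be * (c 1%N * d 2%N + c 2%N * d 1%N) + (l - 1 - be) * (c 2%N * d 2%N)
  + n * k * (c 3%N * d 3%N) + n * l * (c 4%N * d 4%N).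
Proof.
by rewrite /wreath_prod !big_ord_recl !big_ord0 /wreath_coef /bump /=; ring.
Qed.

Lemma wreath_prod3 c d : wreath_prod c d 3 =
  c 0%N * d 3%N + c 3%N * d 0%N + k * (c 1%N * d 3%N + c 3%N * d 1%N)
  + l * (c 2%N * d 3%N + c 3%N * d 2%N)
  + n * ((k - 1 - al) * (c 3%N * d 3%N) + al * (c 3%N * d 4%N + c 4%N * d 3%N)
         + (l - al) * (c 4%N * d 4%N)).
Proof.
by rewrite /wreath_prod !big_ord_recl !big_ord0 /wreath_coef /bump /=; ring.
Qed.

Lemma wreath_prod4 c d : wreath_prod c d 4 =
  c 0%N * d 4%N + c 4%N * d 0%N + k * (c 1%N * d 4%N + c 4%N * d 1%N)
  + l * (c 2%N * d 4%N + c 4%N * d 2%N)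
  + n * ((k - be) * (c 3%N * d 3%N) + be * (c 3%N * d 4%N + c 4%N * d 3%N)
         + (l - 1 - be) * (c 4%N * d 4%N)).
Proof.
by rewrite /wreath_prod !big_ord_recl !big_ord0 /wreath_coef /bump /=; ring.
Qed.

Definition wreath_prodE := (wreath_prod1, wreath_prod2, wreath_prod3, wreath_prod4).

(* Coordinate 0 belongs to the identity, so the block labelled i has
   coordinate i.+1. *)
Definition const_on (T : eqType) (ps : seq (seq nat)) (c : nat -> T) :=
  all (fun p => all (fun i => c i.+1 == c (head 0%N p).+1) p) ps.

Definition closed_on ps := forall c d : nat -> C,
  const_on ps c -> const_on ps d -> const_on ps (wreath_prod c d).

Lemma closed_always ps : ps \in always_parts -> closed_on ps.
Proof.
rewrite !inE => ps_in c d.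
case/or4P: ps_in => [|||/orP[]] /eqP->; rewrite /const_on /= !eqxx ?andbT //=.
- move=> /eqP c4 /eqP d4; apply/eqP; rewrite !wreath_prodE c4 d4; ring.
- move=> /eqP c2 /eqP d2; apply/eqP; rewrite !wreath_prodE c2 d2; ring.
- move=> /andP[/eqP c2 /eqP c4] /andP[/eqP d2 /eqP d4].
  by apply/andP; split; apply/eqP; rewrite !wreath_prodE c2 d2 c4 d4; ring.
move=> /and3P[/eqP c2 /eqP c3 /eqP c4] /and3P[/eqP d2 /eqP d3 /eqP d4].
by apply/and3P; split; apply/eqP; rewrite !wreath_prodE c2 d2 c3 d3 c4 d4; ring.
Qed.

Lemma closed_mu_eq0 ps : be = k -> al = 0 -> ps \in mu_parts -> closed_on ps.
Proof.
move=> Ebe Eal; rewrite !inE => ps_in c d.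
case/or3P: ps_in => /eqP->; rewrite /const_on /= !eqxx ?andbT //=.
- move=> /andP[/eqP c3 /eqP c4] /andP[/eqP d3 /eqP d4].
  by apply/andP; split; apply/eqP; rewrite !wreath_prodE c3 d3 c4 d4 ?Ebe ?Eal; ring.
- move=> /andP[/eqP c2 /eqP c3] /andP[/eqP d2 /eqP d3].
  by apply/andP; split; apply/eqP; rewrite !wreath_prodE c2 d2 c3 d3 ?Ebe ?Eal; ring.
by move=> /eqP c3 /eqP d3; apply/eqP; rewrite !wreath_prodE c3 d3 ?Ebe ?Eal; ring.
Qed.

Lemma closed_ga_eq0 ps : al = l -> be = 0 -> ps \in ga_parts -> closed_on ps.
Proof.
move=> Eal Ebe; rewrite !inE => ps_in c d.
case/or3P: ps_in => /eqP->; rewrite /const_on /= !eqxx ?andbT //=.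
- move=> /andP[/eqP c3 /eqP c4] /andP[/eqP d3 /eqP d4].
  by apply/andP; split; apply/eqP; rewrite !wreath_prodE c3 d3 c4 d4 ?Ebe ?Eal; ring.
- move=> /andP[/eqP c2 /eqP c4] /andP[/eqP d2 /eqP d4].
  by apply/andP; split; apply/eqP; rewrite !wreath_prodE c2 d2 c4 d4 ?Ebe ?Eal; ring.
by move=> /eqP c4 /eqP d4; apply/eqP; rewrite !wreath_prodE c4 d4 ?Ebe ?Eal; ring.
Qed.

Section Converse.
Hypotheses (k0 : 0 < k) (l0 : 0 < l) (be0 : 0 <= be) (ga0 : 0 <= l - al).
Hypothesis muE : (k - be) * l = al * k.

Let n_neq0 : n != 0. Proof. by rewrite gt_eqF // ltr_wpDl ?addr_ge0 ?ltW. Qed.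

(** Here [p] lists coordinates, not labels: [[:: 1]] stands for the element labelled 0. *)
Let indic (p : seq nat) (i : nat) : C := (i \in p)%:R.

(** The test behind all converse statements: two coordinates of a product in one block must agree.
    Constancy is checked on the boolean vectors [mem q], so the side conditions hold by
    evaluation. *)
Lemma closed_on_eq ps i j q q' : closed_on ps ->
    const_on ps (mem q) -> const_on ps (mem q') ->
    has (fun p => (i \in p) && (j \in p)) ps ->
  wreath_prod (indic q) (indic q') i.+1 = wreath_prod (indic q) (indic q') j.+1.
Proof.
have indicP p : const_on ps (mem p) -> const_on ps (indic p).
  move=> ps_p; apply: sub_all ps_p => b; apply: sub_all => h /eqP /= E.
  by rewrite /indic E.
move=> cl /indicP ps_q /indicP ps_q' /hasP[p p_ps /andP[i_p j_p]].
have /allP/(_ p p_ps)/allP c_p := cl _ _ ps_q ps_q'.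
by rewrite (eqP (c_p i i_p)) (eqP (c_p j j_p)).
Qed.

Lemma n_mul_eq0 x : n * x = 0 -> x = 0.
Proof. by move/eqP; rewrite mulf_eq0 (negPf n_neq0) => /eqP. Qed.

Lemma sub_eq0 (x y z : C) : x = y -> z = x - y -> z = 0.
Proof. by move=> -> ->; apply: subrr. Qed.

Lemma closed_mu_eq0P ps : ps \in mu_parts -> closed_on ps -> be = k.
Proof.
rewrite !inE => ps_in cl; case/or3P: ps_in cl => /eqP-> cl.
(* The square of a (x) 1 has coefficient k - be at b (x) 1 and 0 at J (x) a. *)
- apply/esym/subr0_eq/(sub_eq0 (@closed_on_eq _ 1 2 [:: 1%N] [:: 1%N] cl isT isT isT)).
  by rewrite !wreath_prodE /indic /=; ring.
- apply/(mu_eq0_al k0 l0 muE)/n_mul_eq0.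
  (* The square of J (x) b has coefficients n l at a (x) 1 and n (l - al) at J (x) a. *)
  apply: (sub_eq0 (@closed_on_eq _ 0 2 [:: 4%N] [:: 4%N] cl isT isT isT)).
  by rewrite !wreath_prodE /indic /=; ring.
apply/esym/subr0_eq/(sub_eq0 (@closed_on_eq _ 1 2 [:: 1%N] [:: 1%N] cl isT isT isT)).
by rewrite !wreath_prodE /indic /=; ring.
Qed.

Lemma closed_ga_eq0P ps : ps \in ga_parts -> closed_on ps -> al = l.
Proof.
rewrite !inE => ps_in cl; case/or3P: ps_in cl => /eqP-> cl.
- apply/esym/subr0_eq/(sub_eq0 (@closed_on_eq _ 0 2 [:: 2%N] [:: 2%N] cl isT isT isT)).
  by rewrite !wreath_prodE /indic /=; ring.
- apply/(ga_eq0_be k0 l0 muE)/n_mul_eq0.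
  (* The square of J (x) a has coefficients n k at a (x) 1 and n (k - be) at J (x) b. *)
  apply: (sub_eq0 (@closed_on_eq _ 0 3 [:: 3%N] [:: 3%N] cl isT isT isT)).
  by rewrite !wreath_prodE /indic /=; ring.
apply/esym/subr0_eq/(sub_eq0 (@closed_on_eq _ 0 3 [:: 2%N] [:: 2%N] cl isT isT isT)).
by rewrite !wreath_prodE /indic /=; ring.
Qed.

(** In the first two cases two tests give al = l and al = 0, respectively be = k and be = 0. In the
    third, squaring a (x) 1 + J (x) a gives (k + l) be + k = 0. In the fourth, n be + (l - al) = 0
    forces be = 0 and al = l, after which squaring a (x) 1 + J (x) b gives n l + k = 0. *)
Lemma never_closed ps : ps \in never_parts -> ~ closed_on ps.
Proof.
have pos_neq0 (x y : C) : 0 <= x -> 0 < y -> x + y = 0 -> False.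
  by move=> x0 y0 E; have := ltr_wpDl x0 y0; rewrite E ltxx.
rewrite !inE => ps_in cl; case/or4P: ps_in cl => /eqP-> cl.
- have E : l - al = 0.
    apply: (sub_eq0 (@closed_on_eq _ 0 2 [:: 2%N] [:: 2%N] cl isT isT isT)).
    by rewrite !wreath_prodE /indic /=; ring.
  have al0 : al = 0.
    apply: n_mul_eq0.
    apply: (sub_eq0 (@closed_on_eq _ 2 0 [:: 1; 3]%N [:: 4%N] cl isT isT isT)).
    by rewrite !wreath_prodE /indic /=; ring.
  by move: l0; rewrite (subr0_eq E) al0 ltxx.
- have E : k - be = 0.
    apply: (sub_eq0 (@closed_on_eq _ 1 3 [:: 1%N] [:: 1%N] cl isT isT isT)).
    by rewrite !wreath_prodE /indic /=; ring.
  have be_0 : be = 0.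
    apply: n_mul_eq0.
    apply: (sub_eq0 (@closed_on_eq _ 3 1 [:: 2; 4]%N [:: 3%N] cl isT isT isT)).
    by rewrite !wreath_prodE /indic /=; ring.
  by move: k0; rewrite (subr0_eq E) be_0 ltxx.
- apply: (pos_neq0 ((k + l) * be) k) => //.
    by rewrite mulr_ge0 ?addr_ge0 ?(ltW k0) ?(ltW l0).
  apply: (sub_eq0 (@closed_on_eq _ 1 3 [:: 1; 3]%N [:: 1; 3]%N cl isT isT isT)).
  by rewrite !wreath_prodE /indic /=; ring.
have n_ge0 : 0 <= n by rewrite !addr_ge0 ?ltW.
have be_0 : be = 0.
  apply: n_mul_eq0; have: n * be + (l - al) = 0.
    apply: (sub_eq0 (@closed_on_eq _ 0 3 [:: 2; 3]%N [:: 2; 3]%N cl isT isT isT)).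
    by rewrite !wreath_prodE /indic /=; ring.
  by move/eqP; rewrite paddr_eq0 ?mulr_ge0 // => /andP[/eqP].
apply: (pos_neq0 (n * l) k) => //; first by rewrite mulr_ge0 // ltW.
apply: (sub_eq0 (@closed_on_eq _ 1 2 [:: 1; 4]%N [:: 1; 4]%N cl isT isT isT)).
by rewrite !wreath_prodE /indic /= be_0 ((ga_eq0_be k0 l0 muE).2 be_0); ring.
Qed.
End Converse.

End WreathFusion.

(** * Spans of block sums and block-constant coefficients *)

Section SpanOfBlocks.
Variables (C : numClosedFieldType) (T : falgType C) (v : nat -> T).
Variable ps : seq (seq nat).
Hypothesis v0 : v 0%N = 1.
Hypothesis ps_perm : perm_eq (flatten ps) (iota 0 4).

Definition comb (c : nat -> C) := \sum_(h < 5) c h *: v h.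

Definition block_span : {vspace T} :=
  <<1 :: [seq \sum_(i <- p) v i.+1 | p <- ps]>>.

Lemma ps_uniq : uniq (flatten ps).
Proof. by rewrite (perm_uniq ps_perm) iota_uniq. Qed.

Lemma combE c : comb c = c 0%N *: 1 + \sum_(p <- ps) \sum_(i <- p) c i.+1 *: v i.+1.
Proof.
rewrite /comb big_ord_recl v0; congr (_ + _).
rewrite -(big_mkord xpredT (fun i => c i.+1 *: v i.+1)) /index_iota subn0.
by rewrite -(perm_big _ ps_perm) /= big_flatten.
Qed.

Lemma const_on_mem p : p \in ps -> const_on ps (fun h => h.-1 \in p).
Proof.
move=> p_ps; apply/allP => q q_ps; apply/allP => i i_q /=.
have head_q : head 0%N q \in q by case: (q) i_q => //= j q' _; rewrite mem_head.
apply/eqP; apply/idP/idP => i_p.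
  by rewrite (block_of_uniq ps_uniq p_ps q_ps i_p i_q).
by rewrite (block_of_uniq ps_uniq p_ps q_ps i_p head_q).
Qed.

(** Combinations with block-constant coefficients form a subspace that contains 1 and the block
    sums; conversely, the constant factors out of each block. *)
Lemma block_spanP x :
  x \in block_span <-> exists2 c, const_on ps c & x = comb c.
Proof.
split=> [|[c c_ps ->]]; last first.
  rewrite combE; apply: rpredD; first by rewrite rpredZ // memv_span ?mem_head.
  rewrite big_seq; apply: rpred_sum => p p_ps.
  have -> : \sum_(i <- p) c i.+1 *: v i.+1 =
            c (head 0%N p).+1 *: \sum_(i <- p) v i.+1.
    rewrite scaler_sumr big_seq [RHS]big_seq; apply: eq_bigr => i i_p.
    by have /allP/(_ p p_ps)/allP/(_ i i_p)/eqP-> := c_ps.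
  by rewrite rpredZ // memv_span // inE (map_f (fun p => \sum_(i <- p) v i.+1)) ?orbT.
pose S y := exists2 c, const_on ps c & y = comb c.
have S0 : S 0.
  exists (fun=> 0); first by apply/allP => p _; apply/allP => i _ /=.
  by rewrite /comb big1 // => i _; rewrite scale0r.
have SD y z : S y -> S z -> S (y + z).
  move=> [c c_ps ->] [d d_ps ->]; exists (fun h => c h + d h).
    apply/allP => p p_ps; apply/allP => i i_p /=.
    have /allP/(_ p p_ps)/allP/(_ i i_p)/eqP-> := c_ps.
    by have /allP/(_ p p_ps)/allP/(_ i i_p)/eqP-> := d_ps.
  by rewrite /comb -big_split; apply: eq_bigr => i _; rewrite scalerDl.
have SZ u y : S y -> S (u *: y).
  move=> [c c_ps ->]; exists (fun h => u * c h).
    apply/allP => p p_ps; apply/allP => i i_p /=.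
    by have /allP/(_ p p_ps)/allP/(_ i i_p)/eqP-> := c_ps.
  by rewrite /comb scaler_sumr; apply: eq_bigr => i _; rewrite scalerA.
have S1 : S 1.
  exists (fun h => (h == 0)%:R); first by apply/allP => p _; apply/allP => i _ /=.
  rewrite /comb big_ord_recl /= scale1r v0 big1 ?addr0 // => i _.
  by rewrite scale0r.
have Sp p : p \in ps -> S (\sum_(i <- p) v i.+1).
  (* The conjunct [h != 0] keeps out the coordinate of the identity, since [0.-1] is 0 and may lie
     in [p]. *)
  move=> p_ps; exists (fun h => ((h != 0) && (h.-1 \in p))%:R).
    have := const_on_mem p_ps; apply: sub_all => q; apply: sub_all => i /eqP /= E.
    by rewrite E.
  rewrite /comb big_ord_recl /= scale0r add0r.
  rewrite -(big_mkord xpredT (fun i => (i \in p)%:R *: v i.+1)) /index_iota subn0.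
  rewrite -(perm_big _ ps_perm) /= [RHS](bigID (mem p)) /=.
  rewrite [X in _ + X]big1 ?addr0; last first.
    by move=> i /negPf->; rewrite scale0r.
  under [RHS]eq_bigr => i -> do rewrite scale1r.
  rewrite -[RHS]big_filter; apply: perm_big; apply: uniq_perm.
  - exact: uniq_block ps_uniq p_ps.
  - by rewrite filter_uniq ?ps_uniq.
  move=> i; rewrite mem_filter andb_idr // => i_p.
  by apply/flattenP; exists p.
rewrite /block_span => /(@coord_span _ _ _ (in_tuple _)) ->.
elim/big_ind: _ => // i _; apply: SZ.
have: (in_tuple (1 :: [seq \sum_(i <- p) v i.+1 | p <- ps]))`_i \in
        1 :: [seq \sum_(i <- p) v i.+1 | p <- ps] by exact: mem_nth.
rewrite inE => /predU1P[->//|/mapP[p p_ps ->]]; exact: Sp.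
Qed.

End SpanOfBlocks.

(** * Free families with the multiplication of the wreath product *)

Section WreathBasis.
Variable C : numClosedFieldType.

(** This interface is all that the closure criterion sees of the tensor square, so the two orders of
    the factors are treated at once. *)
Record wreath_basis (T : falgType C) (v : nat -> T) (k l al be : C) : Prop := {
  wreath_v0 : v 0%N = 1;
  wreath_mul : forall i j : 'I_5,
    v i * v j = comb v (wreath_coef k l al be i j);
  wreath_free : forall c, comb v c = 0 -> forall h : 'I_5, c h = 0
}.

Lemma eq_wreath_basis (T : falgType C) (v w : nat -> T) k l al be :
  (forall h : 'I_5, v h = w h) ->
  wreath_basis w k l al be -> wreath_basis v k l al be.
Proof.
move=> vw [w0 wM wfree].
have combE c : comb v c = comb w c by apply: eq_bigr => h _; rewrite vw.
split=> [|i j|c]; rewrite ?combE; first by rewrite (vw ord0).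
  by rewrite !vw wM.
exact: wfree.
Qed.

Section Closure.
Variables (T : falgType C) (v : nat -> T) (k l al be : C).
Hypothesis wv : wreath_basis v k l al be.

Lemma comb_mul c d : comb v c * comb v d = comb v (wreath_prod k l al be c d).
Proof.
rewrite /comb mulr_suml.
under [RHS]eq_bigr => h _ do rewrite /wreath_prod scaler_suml.
rewrite [RHS]exchange_big; apply: eq_bigr => i _.
under [RHS]eq_bigr => h _ do rewrite scaler_suml.
rewrite mulr_sumr [RHS]exchange_big; apply: eq_bigr => j _.
rewrite -scalerAl -scalerAr scalerA (wreath_mul wv) /comb scaler_sumr.
by apply: eq_bigr => h _; rewrite scalerA.
Qed.

Lemma comb_inj c d : comb v c = comb v d -> forall h : 'I_5, c h = d h.
Proof.
move=> E h; apply/eqP; rewrite -subr_eq0; apply/eqP.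
apply: (wreath_free wv (c := fun h => c h - d h)).
rewrite /comb; under eq_bigr do rewrite scalerBl.
by rewrite sumrB -!/(comb v _) E subrr.
Qed.

(** By freeness, a product lies in the span only if its own coefficient vector is block-constant. *)
Lemma block_span_closedP ps : perm_eq (flatten ps) (iota 0 4) ->
  {in block_span v ps &, forall x y, x * y \in block_span v ps}
  <-> closed_on k l al be ps.
Proof.
move=> ps_perm; have spanP := block_spanP (wreath_v0 wv) ps_perm; split=> cl.
  move=> c d c_ps d_ps; have /spanP[e e_ps] : comb v c * comb v d \in block_span v ps.
    by apply: cl; apply/spanP; [exists c | exists d].
  rewrite comb_mul => /comb_inj E; apply/allP => p p_ps; apply/allP => i i_p.
  (* [comb] determines coefficients only below 5, so the labels in [ps] have to be bounded. *)
  have lt4 j : j \in p -> (j.+1 < 5)%N.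
    move=> j_p; have : j \in flatten ps by apply/flattenP; exists p.
    by rewrite (perm_mem ps_perm) mem_iota.
  have head_p : head 0%N p \in p by case: (p) i_p => //= j q _; rewrite mem_head.
  rewrite (E (Ordinal (lt4 _ i_p))) (E (Ordinal (lt4 _ head_p))) /=.
  by have /allP/(_ p p_ps)/allP/(_ i i_p) := e_ps.
move=> _ _ /spanP[c c_ps ->] /spanP[d d_ps ->]; apply/spanP.
by exists (wreath_prod k l al be c d); [apply: cl | rewrite comb_mul].
Qed.

End Closure.

(* Stated for a bilinear map tt, so that it applies to both x (x) y and y (x) x. *)
Section Bilinear.
Variables (A : rank3_sita C) (T : falgType C) (tt : A -> A -> T).
Variables (k l al be : C).
Hypothesis num : intersection_numbers A k l al be.
Hypotheses (ttDl : forall x y z, tt (x + y) z = tt x z + tt y z)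
  (ttDr : forall x y z, tt x (y + z) = tt x y + tt x z)
  (ttZl : forall c x y, tt (c *: x) y = c *: tt x y)
  (ttZr : forall c x y, tt x (c *: y) = c *: tt x y)
  (ttM : forall x y x' y', tt x y * tt x' y' = tt (x * x') (y * y'))
  (tt1 : tt 1 1 = 1).
Hypothesis tt_dual : forall f g : {scalar A},
  exists F : {scalar T}, forall x y, F (tt x y) = f x * g y.

Local Notation a := (sita_basis A)`_1.
Local Notation b := (sita_basis A)`_2.
Local Notation J := (1 + a + b).

Lemma int_21 : b * a = al *: a + be *: b.
Proof. by rewrite sita_mulC (int_12 num). Qed.

Definition wreath_vec (h : nat) : T :=
  nth 0 [:: 1; tt a 1; tt b 1; tt J a; tt J b] h.

(** Coordinates turn identities in the algebra into [ring] goals over [C]. *)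
Let lin (x y z : C) : A := x *: 1 + y *: a + z *: b.

Let linD x y z x' y' z' :
  lin x y z + lin x' y' z' = lin (x + x') (y + y') (z + z').
Proof. by rewrite /lin !scalerDl [LHS]addrACA; congr (_ + _); rewrite addrACA. Qed.

Let linZ c x y z : c *: lin x y z = lin (c * x) (c * y) (c * z).
Proof. by rewrite /lin !scalerDr !scalerA. Qed.

Let lina : a = lin 0 1 0.
Proof. by rewrite /lin !scale0r addr0 add0r scale1r. Qed.
Let linb : b = lin 0 0 1. Proof. by rewrite /lin !scale0r !add0r scale1r. Qed.
Let linJ : J = lin 1 1 1. Proof. by rewrite /lin !scale1r. Qed.
Let lin_aa : a * a = lin k (k - 1 - al) (k - be). Proof. exact: int_11 num. Qed.
Let lin_bb : b * b = lin l (l - al) (l - 1 - be). Proof. exact: int_22 num. Qed.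
Let lin_ab : a * b = lin 0 al be.
Proof. by rewrite /lin scale0r add0r (int_12 num). Qed.
Let lin_ba : b * a = lin 0 al be. Proof. by rewrite sita_mulC lin_ab. Qed.

Lemma sumJ_mula : J * a = k *: J.
Proof.
rewrite !mulrDl mul1r lin_aa lin_ba [X in X + _ + _]lina linJ linZ !linD.
by congr (lin _ _ _); ring.
Qed.

Lemma sumJ_mulb : J * b = l *: J.
Proof.
rewrite !mulrDl mul1r lin_ab lin_bb [X in X + _ + _]linb linJ linZ !linD.
by congr (lin _ _ _); ring.
Qed.

Lemma sumJ_mulJ : J * J = (1 + k + l) *: J.
Proof. by rewrite !mulrDr mulr1 sumJ_mula sumJ_mulb !scalerDl scale1r. Qed.

Lemma wreath_vec_mul (i j : 'I_5) :
  wreath_vec i * wreath_vec j = comb wreath_vec (wreath_coef k l al be i j).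
Proof.
rewrite /comb !big_ord_recl big_ord0 addr0 /wreath_vec /=.
have J1 : tt J 1 = 1 + tt a 1 + tt b 1 by rewrite !ttDl tt1.
have aJ : a * J = k *: J by rewrite sita_mulC sumJ_mula.
have bJ : b * J = l *: J by rewrite sita_mulC sumJ_mulb.
(* J is generalised so that distributivity does not expand it inside J (x) a and J (x) b; only J (x)
   1, which is not in the family, is expanded, by [j1]. *)
move: J (sumJ_mula) (sumJ_mulb) (sumJ_mulJ) J1 aJ bJ => jj ja jb jJ j1 aj bj.
case: i => [[|[|[|[|[|//]]]]]] ?; case: j => [[|[|[|[|[|//]]]]]] ?;
rewrite /wreath_coef /=
  ?(mul1r, mulr1, ttM, int_11 num, int_12 num, int_22 num, int_21, ja, jb, jJ, aj, bj);
by rewrite ?(ttDl, ttDr, ttZl, ttZr, scalerDr, scalerA, scale0r, scale1r, add0r, addr0,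
  tt1, j1, addrA).
Qed.

(** [tt_dual] applies the product of the [i]-th and [j]-th coordinate forms to the relation; the
    pairs (0,0), (1,0), (2,0), (0,1), (0,2) isolate the five coefficients. *)
Lemma wreath_vec_free c : comb wreath_vec c = 0 -> forall h : 'I_5, c h = 0.
Proof.
rewrite /comb !big_ord_recl big_ord0 addr0 /wreath_vec /= -tt1 => E.
have fr := basis_free (sita_basisP A).
pose f (i : 'I_3) : {scalar A} := coord (sita_basis A) i.
have f1 i : f i 1 = (0%N == i)%:R.
  by rewrite -(sita_basis1 A) /f /= (coord_free 0 i fr).
have fa i : f i a = (1%N == i)%:R.
  by rewrite /f /= (coord_free (Ordinal (isT : (1 < 3)%N)) i fr).
have fb i : f i b = (2%N == i)%:R.
  by rewrite /f /= (coord_free (Ordinal (isT : (2 < 3)%N)) i fr).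
have dual (i j : 'I_3) :
    c 0%N * ((0%N == i)%:R * (0%N == j)%:R)
    + (c 1%N * ((1%N == i)%:R * (0%N == j)%:R)
    + (c 2%N * ((2%N == i)%:R * (0%N == j)%:R)
    + (c 3%N * (((0%N == i)%:R + (1%N == i)%:R + (2%N == i)%:R) * (1%N == j)%:R)
    + c 4%N * (((0%N == i)%:R + (1%N == i)%:R + (2%N == i)%:R) * (2%N == j)%:R)))) = 0.
  have [F FE] := tt_dual (f i) (f j); have := congr1 F E.
  by rewrite !linearD !linearZ /= !FE linear0 !linearD !(f1, fa, fb).
case=> [[|[|[|[|[|//]]]]]] ? /=.
- by rewrite -[RHS](dual 0 0) /=; ring.
- by rewrite -[RHS](dual (Ordinal (isT : (1 < 3)%N)) 0) /=; ring.
- by rewrite -[RHS](dual (Ordinal (isT : (2 < 3)%N)) 0) /=; ring.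
- by rewrite -[RHS](dual 0 (Ordinal (isT : (1 < 3)%N))) /=; ring.
- by rewrite -[RHS](dual 0 (Ordinal (isT : (2 < 3)%N))) /=; ring.
Qed.

Lemma wreath_vec_basis : wreath_basis wreath_vec k l al be.
Proof. by split=> //; [apply: wreath_vec_mul | apply: wreath_vec_free]. Qed.

End Bilinear.
End WreathBasis.

(** * Tensor products of linear forms *)

Section TensorForm.
Variables (K : fieldType) (A B : falgType K) (f : {scalar A}) (g : {scalar B}).

Definition tens_form (u : tensor A B) : K :=
  \sum_i \sum_j u i j * (f (r2v (delta_mx 0 i)) * g (r2v (delta_mx 0 j))).

Fact tens_form_is_scalar : scalar tens_form.
Proof.
move=> c u v; rewrite /tens_form mulr_sumr -big_split; apply: eq_bigr => i _.
rewrite mulr_sumr -big_split; apply: eq_bigr => j _.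
by rewrite !mxE /= mulrDl -mulrA.
Qed.

HB.instance Definition _ :=
  GRing.isLinear.Build K (tensor A B) K *%R tens_form tens_form_is_scalar.

Lemma tens_formE a b : tens_form (tens a b) = f a * g b.
Proof.
rewrite [in RHS](r2v_sumE a) [in RHS](r2v_sumE b) !linear_sum mulr_suml.
apply: eq_bigr => i _; rewrite mulr_sumr; apply: eq_bigr => j _.
by rewrite !linearZ /= !mxE big_ord1 !mxE; ring.
Qed.

End TensorForm.

(** * Block sums in the tensor square *)

Section BlockSums.
Variable C : numClosedFieldType.

Lemma sum_block (V : zmodType) (F : nat -> V) b : uniq b -> all (gtn 10) b ->
  \sum_(t in [set t : 'I_10 | (t : nat) \in b]) F t = \sum_(t <- b) F t.
Proof.
move=> u_b /allP b_lt; under eq_bigl do rewrite inE.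
rewrite -(big_mkord (mem b) F) -big_filter; apply: perm_big; apply: uniq_perm => //.
  by rewrite filter_uniq ?iota_uniq.
move=> t; rewrite mem_filter mem_index_iota andb_idr // => t_b.
exact: b_lt.
Qed.

Definition block_vec (A : rank3_sita C) (bs : seq (seq nat)) (h : nat) : tensor A A :=
  if h is i.+1 then \sum_(t <- nth [::] bs i) tsq_basis A t else 1.

Lemma fusion_space_union (A : rank3_sita C) bs ps :
    all (fun b => uniq b && all (gtn 10) b) (blocks bs ps) ->
  fusion_space A (union_part bs ps) = block_span (block_vec A bs) ps.
Proof.
move=> /allP ok.
have C1 : tsq_basis A 1 = 1 by rewrite /tsq_basis /= !sita_basis1.
have sumE p : p \in ps ->
    \sum_(t in [set t : 'I_10 | (t : nat) \in flatten [seq nth [::] bs i | i <- p]])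
      tsq_basis A t = \sum_(i <- p) block_vec A bs i.+1.
  move=> p_ps; have /andP[u_p lt_p] := ok _ (map_f _ p_ps).
  by rewrite sum_block // big_flatten big_map.
rewrite /fusion_space /block_span C1; apply/eqP; rewrite eqEsubv.
apply/andP; split; apply/sub_span => x; rewrite !inE => /predU1P[->|]; rewrite ?eqxx //.
  case/imageP=> T /mem_part[_ /mapP[p p_ps ->] ->] ->; rewrite sumE //.
  by rewrite (map_f (fun p => \sum_(i <- p) block_vec A bs i.+1)) ?orbT.
case/mapP=> p p_ps ->; rewrite -sumE //; apply/orP; right.
apply/imageP; eexists; last reflexivity.
by apply/mem_part; eexists; last reflexivity; apply/mapP; exists p.
Qed.

Lemma block_vec_wreath1 (A : rank3_sita C) k l al be :
  intersection_numbers A k l al be ->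
  wreath_basis (block_vec A [:: [:: 2]; [:: 3]; [:: 4; 5; 6]; [:: 7; 8; 9]]%N) k l al be.
Proof.
move=> num; apply: eq_wreath_basis (wreath_vec_basis num (@tensDl _ _ _) (@tensDr _ _ _)
  (@tensZl _ _ _) (@tensZr _ _ _) (@tensM _ _ _) (@tens1 _ _ _) _).
  case=> [[|[|[|[|[|//]]]]]] ?; rewrite /wreath_vec /= ?big_cons ?big_nil ?addr0 //;
  by rewrite /tsq_basis /= ?sita_basis1 ?tensDl ?addrA.
by move=> f g; exists (tens_form f g) => x y; apply: tens_formE.
Qed.

Lemma block_vec_wreath2 (A : rank3_sita C) k l al be :
  intersection_numbers A k l al be ->
  wreath_basis (block_vec A [:: [:: 4]; [:: 7]; [:: 2; 5; 8]; [:: 3; 6; 9]]%N) k l al be.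
Proof.
(* With the factors flipped, the family is 1, 1 (x) a, 1 (x) b, a (x) J, b (x) J, whence the order
   4, 7, 258, 369 of the blocks. *)
move=> num; pose tt (x y : A) : tensor A A := tens y x.
have tt1 : tt 1 1 = 1 by [].
apply: eq_wreath_basis (wreath_vec_basis num (tt := tt) _ _ _ _ _ tt1 _);
  rewrite /tt.
- case=> [[|[|[|[|[|//]]]]]] ?; rewrite /wreath_vec /= ?big_cons ?big_nil ?addr0 //;
  by rewrite /tsq_basis /= ?sita_basis1 ?tensDr ?addrA.
- by move=> x y z; rewrite tensDr.
- by move=> x y z; rewrite tensDl.
- by move=> c x y; rewrite tensZr.
- by move=> c x y; rewrite tensZl.
- by move=> x y x' y'; rewrite tensM.
by move=> f g; exists (tens_form g f) => x y; rewrite mulrC; apply: tens_formE.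
Qed.

End BlockSums.

(** * Classification of the fusions *)

Section Classification.
Variables (R : realType) (bs : seq (seq nat)).
Local Notation C := R[i].
Hypotheses (bs_perm : perm_eq (flatten bs) (iota 2 8)) (bs_nil : [::] \notin bs).
Hypothesis bs_size : size bs = 4.
Hypothesis bs_ok :
  all (fun ps => all (fun b => uniq b && all (gtn 10) b) (blocks bs ps)) all_parts.
Hypothesis bs_wreath : forall (A : rank3_sita C) (k l al be : C),
  intersection_numbers A k l al be -> wreath_basis (block_vec A bs) k l al be.

Lemma gives_fusionP (A : rank3_sita C) k l al be ps :
    intersection_numbers A k l al be -> ps \in all_parts ->
  gives_fusion A (union_part bs ps) <-> closed_on k l al be ps.
Proof.
move=> num ps_in; rewrite /gives_fusion fusion_space_union; last exact: (allP bs_ok).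
apply: (block_span_closedP (bs_wreath num)).
have : all (fun ps => perm_eq (flatten ps) (iota 0 4)) all_parts by [].
by move/allP/(_ ps ps_in).
Qed.

Variables La L1 L2 : seq (seq (seq nat)).
Hypotheses (LaE : same_parts La (map (blocks bs) always_parts))
  (L1E : same_parts L1 (map (blocks bs) mu_parts))
  (L2E : same_parts L2 (map (blocks bs) ga_parts)).

Lemma map_union_part L M : same_parts L (map (blocks bs) M) ->
  map part L =i map (union_part bs) M.
Proof. by move/map_part_eq=> E x; rewrite E -map_comp. Qed.

Lemma fusion_classification (tau : {set {set 'I_10}}) :
    partition tau idx29 -> coarsens tau (part bs) ->
  ((forall (A : rank3_sita C) (k l r s : C),
      character_table A (rank3_table k l r s) -> s <= r -> gives_fusion A tau)
   <-> tau \in map part La)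
  /\ (tau \notin map part La ->
      forall (A : rank3_sita C) (k l r s : C),
        character_table A (rank3_table k l r s) -> s <= r ->
        (gives_fusion A tau <->
           [/\ k = r, s = -1 & tau \in map part L1]
           \/ [/\ l = -1 - s, r = 0 & tau \in map part L2])).
Proof.
move=> tauP tau_bs.
rewrite (map_union_part LaE) (map_union_part L1E) (map_union_part L2E).
have always_fusion (A : rank3_sita C) (k l r s : C) :
    character_table A (rank3_table k l r s) ->
    tau \in map (union_part bs) always_parts -> gives_fusion A tau.
  move=> tab /mapP[ps ps_in ->].
  have [al [be num]] := table_intersection_numbers tab.
  have ps_all : ps \in all_parts by rewrite /all_parts mem_cat ps_in.
  by apply/(gives_fusionP num ps_all)/closed_always.
have other_fusion : tau \notin map (union_part bs) always_parts ->
    forall (A : rank3_sita C) (k l r s : C),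
    character_table A (rank3_table k l r s) -> s <= r ->
    (gives_fusion A tau <->
       [/\ k = r, s = -1 & tau \in map (union_part bs) mu_parts]
       \/ [/\ l = -1 - s, r = 0 & tau \in map (union_part bs) ga_parts]).
  move=> tau_na A k l r s tab le_sr.
  have [al [be num]] := table_intersection_numbers tab.
  have k0 := int_kgt0 num; have l0 := int_lgt0 num; have muE := int_muE num.
  split=> [fus|]; last first.
    case=> [[kr s1 /mapP[ps ps_in ->]] | [ls r0 /mapP[ps ps_in ->]]].
      have ps_all : ps \in all_parts by rewrite /all_parts !mem_cat ps_in orbT.
      have Ebe : be = k by apply/(mu_eq0P tab le_sr num).
      apply/(gives_fusionP num ps_all)/closed_mu_eq0 => //.
      exact/(mu_eq0_al k0 l0 muE).
    have ps_all : ps \in all_parts by rewrite /all_parts !mem_cat ps_in !orbT.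
    have Eal : al = l by apply/(ga_eq0P tab le_sr num).
    by apply/(gives_fusionP num ps_all)/closed_ga_eq0 => //; apply/(ga_eq0_be k0 l0 muE).
  have tauE := coarsens_union_part bs_perm bs_nil tauP tau_bs.
  rewrite bs_size in tauE.
  have [ps ps_in same] := all_partsP
    (fun i => pblock tau (inord (head 0%N (nth [::] bs i)) : 'I_10)).
  rewrite (union_part_eq bs same) in tauE.
  rewrite tauE in tau_na fus *; move/(gives_fusionP num ps_in): fus => cl.
  move: (ps_in); rewrite /all_parts !mem_cat => /or4P[]{}ps_in.
  - by rewrite map_f in tau_na.
  - left; have /(mu_eq0P tab le_sr num)[? ?] := closed_mu_eq0P k0 l0 muE ps_in cl.
    by split=> //; apply: map_f.
  - right; have /(ga_eq0P tab le_sr num)[? ?] := closed_ga_eq0P k0 l0 muE ps_in cl.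
    by split=> //; apply: map_f.
  by case: (never_closed k0 l0 (int_be num) (int_ga num) muE ps_in cl).
split=> //; split=> [fus|tau_a A k l r s tab _]; last exact: always_fusion tab tau_a.
(* A partition outside the list that always gives a fusion would give one for the Paley scheme,
   forcing 4 = 1 or 1 = 0. *)
apply/negPn/negP => tau_na.
have paley_le : - 2%:R <= 1 :> C by rewrite (@le_trans _ _ 0) ?oppr_le0 ?ler0n ?ler01.
have tab := paley_character_table C.
case/(other_fusion tau_na _ _ _ _ _ tab paley_le): (fus _ _ _ _ _ tab paley_le).
  by case=> /eqP; rewrite pnatr_eq1.
by case=> _ /eqP; rewrite oner_eq0.
Qed.

End Classification.

Theorem theorem3p1 (R : realType) :
  (forall tau : {set {set 'I_10}},
     partition tau idx29 ->
     coarsens tau (part [:: [:: 2]; [:: 3]; [:: 4; 5; 6]; [:: 7; 8; 9]]%N) ->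
     let always : seq {set {set 'I_10}} :=
       [:: part [:: [:: 2]; [:: 3]; [:: 4; 5; 6]; [:: 7; 8; 9]];
           part [:: [:: 2]; [:: 3]; [:: 4; 5; 6; 7; 8; 9]];
           part [:: [:: 2; 3]; [:: 4; 5; 6]; [:: 7; 8; 9]];
           part [:: [:: 2; 3]; [:: 4; 5; 6; 7; 8; 9]];
           part [:: [:: 2; 3; 4; 5; 6; 7; 8; 9]]]%N in
     ((forall (A : rank3_sita R[i]) (k l r s : R[i]),
         character_table A (rank3_table k l r s) -> s <= r ->
         gives_fusion A tau)
      <-> tau \in always)
     /\ (tau \notin always ->
         forall (A : rank3_sita R[i]) (k l r s : R[i]),
           character_table A (rank3_table k l r s) -> s <= r ->
           (gives_fusion A tau <->
              [/\ k = r, s = -1 &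
                  tau \in [:: part [:: [:: 2]; [:: 3; 4; 5; 6; 7; 8; 9]];
                              part [:: [:: 2; 3; 4; 5; 6]; [:: 7; 8; 9]];
                              part [:: [:: 2]; [:: 3; 4; 5; 6]; [:: 7; 8; 9]]]%N]
              \/
              [/\ l = -1 - s, r = 0 &
                  tau \in [:: part [:: [:: 2; 4; 5; 6; 7; 8; 9]; [:: 3]];
                              part [:: [:: 2; 3; 7; 8; 9]; [:: 4; 5; 6]];
                              part [:: [:: 2; 7; 8; 9]; [:: 3]; [:: 4; 5; 6]]]%N])))
  /\
  (forall tau : {set {set 'I_10}},
     partition tau idx29 ->
     coarsens tau (part [:: [:: 2; 5; 8]; [:: 3; 6; 9]; [:: 4]; [:: 7]]%N) ->
     let always : seq {set {set 'I_10}} :=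
       [:: part [:: [:: 2; 5; 8]; [:: 3; 6; 9]; [:: 4]; [:: 7]];
           part [:: [:: 2; 5; 8]; [:: 3; 6; 9]; [:: 4; 7]];
           part [:: [:: 2; 3; 5; 6; 8; 9]; [:: 4]; [:: 7]];
           part [:: [:: 2; 3; 5; 6; 8; 9]; [:: 4; 7]];
           part [:: [:: 2; 3; 4; 5; 6; 7; 8; 9]]]%N in
     ((forall (A : rank3_sita R[i]) (k l r s : R[i]),
         character_table A (rank3_table k l r s) -> s <= r ->
         gives_fusion A tau)
      <-> tau \in always)
     /\ (tau \notin always ->
         forall (A : rank3_sita R[i]) (k l r s : R[i]),
           character_table A (rank3_table k l r s) -> s <= r ->
           (gives_fusion A tau <->
              [/\ k = r, s = -1 &
                  tau \in [:: part [:: [:: 2; 3; 5; 6; 7; 8; 9]; [:: 4]];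
                              part [:: [:: 2; 4; 5; 7; 8]; [:: 3; 6; 9]];
                              part [:: [:: 2; 5; 7; 8]; [:: 3; 6; 9]; [:: 4]]]%N]
              \/
              [/\ l = -1 - s, r = 0 &
                  tau \in [:: part [:: [:: 2; 3; 4; 5; 6; 8; 9]; [:: 7]];
                              part [:: [:: 2; 5; 8]; [:: 3; 4; 6; 7; 9]];
                              part [:: [:: 2; 5; 8]; [:: 3; 4; 6; 9]; [:: 7]]]%N]))).
Proof.
split=> tau tauP tau_bs.
  set bs := [:: [:: 2]; [:: 3]; [:: 4; 5; 6]; [:: 7; 8; 9]]%N in tau_bs.
  (* For this order of the blocks, the lists in the statement are the images under [blocks bs] by
     computation. *)
  exact: (@fusion_classification R bs isT isT erefl isT
    (@block_vec_wreath1 _) (map (blocks bs) always_parts) (map (blocks bs) mu_parts)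
    (map (blocks bs) ga_parts) isT isT isT _ tauP tau_bs).
(* The blocks are reordered so that the four labels have the same meaning as in the first half with
   the factors exchanged; the lists then match only up to order. *)
set bs := [:: [:: 4]; [:: 7]; [:: 2; 5; 8]; [:: 3; 6; 9]]%N.
rewrite (@part_eq _ bs) // in tau_bs.
exact: (@fusion_classification R bs isT isT erefl isT (@block_vec_wreath2 _)
  [:: [:: [:: 2; 5; 8]; [:: 3; 6; 9]; [:: 4]; [:: 7]];
      [:: [:: 2; 5; 8]; [:: 3; 6; 9]; [:: 4; 7]];
      [:: [:: 2; 3; 5; 6; 8; 9]; [:: 4]; [:: 7]];
      [:: [:: 2; 3; 5; 6; 8; 9]; [:: 4; 7]];
      [:: [:: 2; 3; 4; 5; 6; 7; 8; 9]]]%N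
  [:: [:: [:: 2; 3; 5; 6; 7; 8; 9]; [:: 4]];
      [:: [:: 2; 4; 5; 7; 8]; [:: 3; 6; 9]];
      [:: [:: 2; 5; 7; 8]; [:: 3; 6; 9]; [:: 4]]]%N
  [:: [:: [:: 2; 3; 4; 5; 6; 8; 9]; [:: 7]];
      [:: [:: 2; 5; 8]; [:: 3; 4; 6; 7; 9]];
      [:: [:: 2; 5; 8]; [:: 3; 4; 6; 9]; [:: 7]]]%N isT isT isT _ tauP tau_bs).
Qed.
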